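(* Let $\Gamma$ be a monoid with identity $e$ and let $A$ be a $\Gamma$-graded $\Bbbk$-algebra. Let $X$ be a reduced affine scheme over $\Bbbk$ that parameterises a set of intermediate series left $A$-modules, in the following sense: for each $x \in X$ there is a $\Gamma$-graded left $A$-module $N^x$ with a $\Bbbk$-basis $\{v^x_\gamma \mid \gamma \in \Gamma\}$, where $v^x_\gamma$ spans $(N^x)_\gamma$, and there is a $\Bbbk$-linear function $\phi: A \to \Bbbk[X]$ such that \[ r\, v^x_e = \phi(r)(x)\, v^x_\gamma \qquad \text{for all } x \in X,\ \gamma \in \Gamma,\ r \in A_\gamma. \] Suppose further that shifting defines a homomorphism $\sigma: \Gamma \to \mathrm{Aut}_\Bbbk(X)$, $\gamma \mapsto \sigma^\gamma$ (so $\sigma^{\gamma\delta} = \sigma^\gamma \circ \sigma^\delta$), such that for all $x\in X$ and $\gamma \in \Gamma$ there is an isomorphism of graded left $A$-modules $N^x(\gamma) \cong N^{\sigma^\gamma(x)}$ which maps $v^x_{\delta\gamma} \in N^x(\gamma)_\delta$ to $v^{\sigma^\gamma(x)}_\delta$ for all $\delta \in \Gamma$. Then the $\Bbbk$-linear map \[ \Phi: A \to \Bbbk[X] \rtimes \Gamma^{\mathrm{op}}, \qquad \Phi(r) = \phi(r)\, t^\gamma \ \text{ for } r \in A_\gamma, \] is a graded antihomomorphism of algebras. Further, \[ \ker \Phi = \bigcap_{x \in X} \mathrm{Ann}_A\, N^x. \]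
   Context: $\Bbbk$ is an algebraically closed field of characteristic zero. A $\Gamma$-graded algebra is $A = \bigoplus_{\gamma\in\Gamma} A_\gamma$ with $A_\gamma A_\delta \subseteq A_{\gamma\delta}$; a $\Gamma$-graded left $A$-module is $N = \bigoplus_{\gamma} N_\gamma$ with $A_\delta N_\gamma \subseteq N_{\delta\gamma}$. An intermediate series module is a $\Gamma$-graded module $N$ with $\dim_\Bbbk N_\gamma = 1$ for all $\gamma \in \Gamma$. For a $\Gamma$-graded left $A$-module $N$ and $\gamma \in \Gamma$, the shift $N(\gamma)$ is the $\Gamma$-graded left $A$-module $N(\gamma) = \bigoplus_{\delta \in \Gamma} N(\gamma)_\delta$ with $N(\gamma)_\delta = N_{\delta\gamma}$. Points $x\in X$ are closed points, at which a function $f \in \Bbbk[X]$ takes a value $f(x) \in \Bbbk$; a function in $\Bbbk[X]$ is determined by its values at the closed points (as is the case when $X$ is reduced of finite type over $\Bbbk$). $\Gamma^{\mathrm{op}}$ is the opposite monoid, with product $\gamma \circ_{\mathrm{op}} \delta = \delta\gamma$. It acts on $\Bbbk[X]$ by $f^\gamma = (\sigma^\gamma)^*(f) = f \circ \sigma^\gamma$, and $\Bbbk[X] \rtimes \Gamma^{\mathrm{op}} = \bigoplus_{\gamma \in \Gamma} \Bbbk[X] t^\gamma$ is the $\Gamma^{\mathrm{op}}$-graded algebra with multiplication determined by $t^\gamma t^\delta = t^{\gamma\circ_{\mathrm{op}}\delta} = t^{\delta\gamma}$ and $t^\gamma f = f^\gamma t^\gamma$ for $f \in \Bbbk[X]$.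 A graded antihomomorphism is an antihomomorphism $\Phi$ with $\Phi(A_\gamma) \subseteq \Bbbk[X]t^\gamma$. *)

(* Defs.v *)
From HB Require Import structures.
From mathcomp Require Import all_boot all_algebra finmap.
From mathcomp Require Import boolp classical_sets.
From mathcomp Require Import monalg.

Set Implicit Arguments.
Unset Strict Implicit.
Unset Printing Implicit Defensive.

Import GRing.Theory.

Local Open Scope classical_set_scope.
Local Open Scope ring_scope.

(** ** Affine schemes over a field, their closed points and automorphisms

    An affine scheme [X] is given by its coordinate ring [B = k[X]]. As a
    [comAlgType] is a nonzero ring, [X] is nonempty. *)

Section Ideals.
Variable B : comPzRingType.

Definition is_ideal (I : set B) : Prop :=
  [/\ I 0, forall f g, I f -> I g -> I (f + g) & forall a f, I f -> I (a * f)].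

Definition is_maximal_ideal (m : set B) : Prop :=
  [/\ is_ideal m, ~ m 1
    & forall I, is_ideal I -> m `<=` I -> ~ I 1 -> I = m].

Record closed_point := ClosedPoint {
  point_ideal : set B;
  point_maximal : is_maximal_ideal point_ideal
}.

End Ideals.

Section AffineScheme.
Variables (k : fieldType) (B : comAlgType k).

(** The value is meaningful when the residue field at [x] is [k]. *)
Definition value (f : B) (x : closed_point B) : k :=
  xget 0 [set c : k | point_ideal x (f - c%:A)].

Record reduced_affine_scheme : Prop := ReducedAffineScheme {
  scheme_reduced : forall (f : B) n, f ^+ n = 0 -> f = 0;
  scheme_kvalued : forall (x : closed_point B) (f : B),
    exists c : k, point_ideal x (f - c%:A);
  scheme_separated : forall f g : B,
    (forall x, value f x = value g x) -> f = g
}.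

Definition is_algebra_automorphism (s : B -> B) : Prop :=
  [/\ zmod_morphism s, monoid_morphism s, scalable s & bijective s].

(** An automorphism [s] of [X] over [k] is given by [s^* : k[X] -> k[X]]. *)
Record aut := Aut {
  pullback : B -> B;
  pullbackP : is_algebra_automorphism pullback
}.

Lemma aut_eqP (s t : aut) : pullback s =1 pullback t -> s = t.
Proof.
case: s t => [s sP] [t tP] /= /funext est; move: tP; rewrite -est => tP.
by congr Aut; exact: Prop_irrelevance.
Qed.

HB.instance Definition _ := gen_eqMixin aut.
HB.instance Definition _ := gen_choiceMixin aut.

Section Pullback.
Variable s : aut.
HB.instance Definition _ := GRing.isZmodMorphism.Build B B (pullback s)
  (let: And4 h _ _ _ := pullbackP s in h).
HB.instance Definition _ := GRing.isMonoidMorphism.Build B B (pullback s)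
  (let: And4 _ h _ _ := pullbackP s in h).
HB.instance Definition _ := GRing.isScalable.Build k B B *:%R (pullback s)
  (let: And4 _ _ h _ := pullbackP s in h).
End Pullback.

Lemma pullback_bij s : bijective (pullback s).
Proof. by case: (pullbackP s). Qed.

Fact aut1_subproof : is_algebra_automorphism (@idfun B).
Proof. by split=> //; exists id. Qed.

Fact autM_subproof s t :
  is_algebra_automorphism (pullback t \o pullback s).
Proof.
split.
- by move=> f g /=; rewrite !rmorphB.
- by split=> [|f g] /=; rewrite ?rmorph1 ?rmorphM.
- by move=> c f /=; rewrite !linearZ.
- exact: (bij_comp (pullback_bij t) (pullback_bij s)).
Qed.

(** Composition of automorphisms of [X]; it reverses pullbacks. *)
Definition aut_one := Aut aut1_subproof.
Definition aut_mul s t := Aut (autM_subproof s t).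

Fact aut_mulA : associative aut_mul.
Proof. by move=> s t u; exact: aut_eqP. Qed.
Fact aut_mul1 : left_id aut_one aut_mul.
Proof. by move=> s; exact: aut_eqP. Qed.
Fact aut_1mul : right_id aut_one aut_mul.
Proof. by move=> s; exact: aut_eqP. Qed.

HB.instance Definition _ :=
  isMonoid.Build aut aut_mulA aut_mul1 aut_1mul.

Fact aut_point_subproof (s : aut) (x : closed_point B) :
  is_maximal_ideal [set f | point_ideal x (pullback s f)].
Proof.
have [[x0 xD xM] x1 xmax] := point_maximal x.
have [t st ts] := pullback_bij s.
split=> /=.
- split=> /= [|f g xf xg|a f xf].
  + by rewrite rmorph0.
  + by rewrite rmorphD; exact: xD.
  + by rewrite rmorphM; exact: xM.
- by rewrite rmorph1.
- move=> I [I0 ID IM] xI I1.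
  suff <- : [set f | I (t f)] = point_ideal x.
    by apply/seteqP; split=> f /=; rewrite st.
  apply: xmax => /=.
  + split=> /= [|f g If Ig|a f If].
    * by rewrite -[0](rmorph0 (pullback s)) st.
    * by rewrite -(ts f) -(ts g) -rmorphD st; exact: ID.
    * by rewrite -(ts f) -(ts a) -rmorphM st; exact: IM.
  + by move=> f xf /=; apply: xI => /=; rewrite ts.
  + by rewrite -[1](rmorph1 (pullback s)) st.
Qed.

Definition aut_point (s : aut) (x : closed_point B) : closed_point B :=
  ClosedPoint (aut_point_subproof s x).

End AffineScheme.

(** ** Gradings

    [{malg V[G]}] is the group of finitely supported functions [G -> V]. *)

Section DirectSum.
Variables (G : choiceType) (V : zmodType) (Vg : G -> set V).

Definition is_decomposition (v : V) (c : {malg V[G]}) : Prop :=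
  (forall g, Vg g c@_g) /\ v = \sum_(g <- msupp c) c@_g.

Definition is_direct_sum : Prop :=
  (forall g, Vg g 0 /\ forall u v, Vg g u -> Vg g v -> Vg g (u - v)) /\
  (forall v, exists! c, is_decomposition v c).

Definition decomposition (v : V) : {malg V[G]} :=
  xget 0 [set c | is_decomposition v c].

Lemma decompositionP v : is_direct_sum -> is_decomposition v (decomposition v).
Proof.
by case=> _ /(_ v) [c [cP _]]; exact: (xgetPex 0 (ex_intro _ c cP)).
Qed.

End DirectSum.

Definition is_graded_algebra (k : fieldType) (G : monoidType)
    (A : algType k) (Ag : G -> set A) : Prop :=
  [/\ is_direct_sum Ag,
      forall g (c : k) a, Ag g a -> Ag g (c *: a)
    & forall g h a b, Ag g a -> Ag h b -> Ag (g * h)%g (a * b)].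

Record graded_algebra (k : fieldType) (G : monoidType) := GradedAlgebra {
  ga_sort :> algType k;
  ga_comp : G -> set ga_sort;
  ga_graded : is_graded_algebra ga_comp
}.

Section GradedModules.
Variables (k : fieldType) (G : monoidType) (A : graded_algebra k G).

(** [k] acts on an [A]-module through [c |-> c%:A]. *)
Definition is_graded_module (N : lmodType A) (Ng : G -> set N) : Prop :=
  [/\ is_direct_sum Ng,
      forall g (c : k) n, Ng g n -> Ng g (c%:A *: n)
    & forall d g a n, ga_comp d a -> Ng g n -> Ng (d * g)%g (a *: n)].

Record graded_module := GradedModule {
  gm_sort :> lmodType A;
  gm_comp : G -> set gm_sort;
  gm_graded : is_graded_module gm_comp
}.

Definition annihilator (N : lmodType A) : set A :=
  [set r | forall n : N, r *: n = 0].

Definition is_basis (N : lmodType A) (v : G -> N) : Prop :=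
  forall n, exists! c : {malg k[G]},
    n = \sum_(g <- msupp c) (c@_g)%:A *: v g.

Record homogeneous_basis (N : graded_module) := HomogeneousBasis {
  hb_vec :> G -> N;
  hb_basis : is_basis hb_vec;
  hb_span : forall g, @gm_comp N g = [set c%:A *: hb_vec g | c in [set: k]]
}.

Lemma hb_mem (N : graded_module) (v : homogeneous_basis N) g :
  gm_comp g (v g).
Proof. by rewrite (hb_span v); exists 1 => //=; rewrite !scale1r. Qed.

(** *** The shift [N(g)]

    Since [d |-> d g] need not be injective, [N(g)] is the external direct sum
    of the [N_(d g)], not a regrading of [N]. *)

Section Shift.
Variables (N : graded_module) (g : G).

Definition in_shift : {pred {malg N[G]}} :=
  fun u => `[< forall d, gm_comp (d * g)%g u@_d >].

Fact in_shift_zmod : zmod_closed in_shift.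
Proof.
have [[Nsub _] _ _] := gm_graded N.
split=> [|u w /asboolP uP /asboolP wP]; apply/asboolP => d.
  by rewrite mcoeff0; case: (Nsub (d * g)%g).
by rewrite mcoeffB; apply: (Nsub _).2.
Qed.

HB.instance Definition _ :=
  GRing.isZmodClosed.Build {malg N[G]} in_shift in_shift_zmod.

Record shift := Shift { shift_val :> {malg N[G]}; _ : shift_val \in in_shift }.

HB.instance Definition _ := [isSub for shift_val].
HB.instance Definition _ := [Choice of shift by <:].
HB.instance Definition _ := [SubChoice_isSubZmodule of shift by <:].

Definition shift_comp (d : G) : set shift :=
  [set u | shift_val u = << (shift_val u)@_d *g d >>].

Fact shift_elt_subproof d (n : N) :
  gm_comp (d * g)%g n -> << n *g d >> \in in_shift.
Proof.
have [[Nsub _] _ _] := gm_graded N.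
move=> nP; apply/asboolP => d'; rewrite mcoeffU.
by case: eqP => [<-//|_]; case: (Nsub (d' * g)%g).
Qed.

(** [n] seen in the degree [d] part of [N(g)]. *)
Definition shift_elt d (n : N) (nP : gm_comp (d * g)%g n) : shift :=
  Shift (shift_elt_subproof nP).

Definition shift_act_val (a : A) (u : {malg N[G]}) : {malg N[G]} :=
  let c := decomposition (@ga_comp _ _ A) a in
  \sum_(b <- msupp c) \sum_(d <- msupp u) << c@_b *: u@_d *g (b * d)%g >>.

Fact shift_act_subproof a (u : shift) : shift_act_val a u \in in_shift.
Proof.
have [_ _ NM] := gm_graded N; have [Asum _ _] := ga_graded A.
have [aP _] := decompositionP a Asum.
rewrite /shift_act_val; apply: rpred_sum => b _; apply: rpred_sum => d _.
apply: shift_elt_subproof; rewrite -mulgA; apply: NM => //.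
by case: u => u /= /asboolP; exact.
Qed.

(** The action with [a n] of degree [d' d] for [a] of degree [d'] and [n] of
    degree [d]. A general monoid grading does not force [1] to have degree
    [1%g], so [1] need not act as the identity on [shift]. *)
Definition shift_act (a : A) (u : shift) : shift :=
  Shift (shift_act_subproof a u).

End Shift.

Record is_graded_iso (U V : zmodType) (actU : A -> U -> U) (actV : A -> V -> V)
    (Ug : G -> set U) (Vg : G -> set V) (theta : U -> V) : Prop := GradedIso {
  iso_zmod : zmod_morphism theta;
  iso_bij : bijective theta;
  iso_act : forall a u, theta (actU a u) = actV a (theta u);
  iso_deg : forall d u, Ug d u -> Vg d (theta u)
}.

Definition is_shift_iso (M N : graded_module) (g : G)
    (theta : shift M g -> N) : Prop :=
  is_graded_iso (@shift_act M g) ( *:%R ) (@shift_comp M g) (@gm_comp N) theta.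

End GradedModules.

(** ** The skew monoid algebra [k[X] ><| G^op]

    Its elements are the finitely supported functions [G -> k[X]], and
    [<< f *g g >>] is [f t^g]. *)

Section Skew.
Local Open Scope fset_scope.
Local Open Scope ring_scope.
Variables (k : fieldType) (G : monoidType) (B : comAlgType k).
Variable sigma : UMagmaMorphism.type G (aut B).

Definition skew_of (s : G -> aut B) : Type := {malg B[G]}.
Local Notation skew := (skew_of sigma).

HB.instance Definition _ := GRing.Zmodule.on skew.

Definition mono (g : G) (f : B) : skew := << f *g g >>.

HB.instance Definition _ g :=
  GRing.isZmodMorphism.Build B skew (mono g) (raddfB (mkmalgU g)).

(** [(f t^g) (f' t^h) = f (f' \o sigma^g) t^(h g)] *)
Definition skew_mul (u w : skew) : skew :=
  \sum_(g <- msupp u) \sum_(h <- msupp w)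
    mono (h * g)%g (u@_g * pullback (sigma g) w@_h).

Definition skew_one : skew := mono 1%g 1.

Definition skew_scale (c : k) (u : skew) : skew :=
  \sum_(g <- msupp u) mono g (c *: u@_g).

Lemma skewE (u : skew) (d : {fset G}) :
  msupp u `<=` d -> u = \sum_(g <- d) mono g u@_g.
Proof. exact: monalgEw. Qed.

Lemma skew_mulE (u w : skew) (d e : {fset G}) :
  msupp u `<=` d -> msupp w `<=` e -> skew_mul u w =
  \sum_(g <- d) \sum_(h <- e)
    mono (h * g)%g (u@_g * pullback (sigma g) w@_h).
Proof.
move=> ud we; rewrite /skew_mul (big_fset_incl _ ud) /=; last first.
  move=> g _ /mcoeff_outdom ug; rewrite big1 // => h _.
  by rewrite ug mul0r raddf0.
apply: eq_bigr => g _; apply: big_fset_incl => // h _ /mcoeff_outdom ->.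
by rewrite rmorph0 mulr0 raddf0.
Qed.

Lemma mono_mul g h f f' : skew_mul (mono g f) (mono h f') =
  mono (h * g)%g (f * pullback (sigma g) f').
Proof.
by rewrite (skew_mulE msuppU_le msuppU_le) !big_seq_fset1 !mcoeffUU.
Qed.

Lemma skew_mulDl : left_distributive skew_mul +%R.
Proof.
move=> u v w; pose d := msupp u `|` msupp v.
rewrite (@skew_mulE _ _ d (msupp w)) ?msuppD_le //.
rewrite (@skew_mulE u _ d (msupp w)) ?fsubsetUl //.
rewrite (@skew_mulE v _ d (msupp w)) ?fsubsetUr //.
rewrite -big_split /=; apply: eq_bigr => g _.
rewrite -big_split /=; apply: eq_bigr => h _.
by rewrite mcoeffD mulrDl raddfD.
Qed.

Lemma skew_mulDr : right_distributive skew_mul +%R.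
Proof.
move=> w u v; pose d := msupp u `|` msupp v.
rewrite (@skew_mulE _ _ (msupp w) d) ?msuppD_le //.
rewrite (@skew_mulE _ u (msupp w) d) ?fsubsetUl //.
rewrite (@skew_mulE _ v (msupp w) d) ?fsubsetUr //.
rewrite -big_split /=; apply: eq_bigr => g _.
rewrite -big_split /=; apply: eq_bigr => h _.
by rewrite mcoeffD rmorphD mulrDr raddfD.
Qed.

Lemma skew_mul0l u : skew_mul 0 u = 0.
Proof. by rewrite /skew_mul msupp0 big_seq_fset0. Qed.

Lemma skew_mul0r u : skew_mul u 0 = 0.
Proof.
by rewrite /skew_mul big1 // => g _; rewrite msupp0 big_seq_fset0.
Qed.

Lemma skew_ind (P : skew -> Prop) :
  P 0 -> (forall u v, P u -> P v -> P (u + v)) ->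
  (forall g f, P (mono g f)) -> forall u, P u.
Proof.
move=> P0 PD PU u; rewrite (skewE (fsubset_refl (msupp u))).
by apply: big_ind => // g _.
Qed.

Fact skew_mulA : associative skew_mul.
Proof.
move=> u v w; elim/skew_ind: u => [|u u' Hu Hu'|g f].
- by rewrite !skew_mul0l.
- by rewrite !skew_mulDl Hu Hu'.
elim/skew_ind: v => [|v v' Hv Hv'|h f'].
- by rewrite skew_mul0r !skew_mul0l skew_mul0r.
- by rewrite skew_mulDl !skew_mulDr skew_mulDl Hv Hv'.
elim/skew_ind: w => [|w w' Hw Hw'|l f''].
- by rewrite !skew_mul0r.
- by rewrite !skew_mulDr Hw Hw'.
by rewrite !mono_mul gmulfM rmorphM mulgA mulrA.
Qed.

Fact skew_mul1l : left_id skew_one skew_mul.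
Proof.
move=> u; elim/skew_ind: u => [|u u' Hu Hu'|g f].
- by rewrite skew_mul0r.
- by rewrite skew_mulDr Hu Hu'.
by rewrite mono_mul gmulf1 mulg1 mul1r.
Qed.

Fact skew_mul1r : right_id skew_one skew_mul.
Proof.
move=> u; elim/skew_ind: u => [|u u' Hu Hu'|g f].
- by rewrite skew_mul0l.
- by rewrite skew_mulDl Hu Hu'.
by rewrite mono_mul rmorph1 mul1g mulr1.
Qed.

Fact skew_oner_neq0 : skew_one != 0.
Proof. by rewrite monalgU_eq0 oner_eq0. Qed.

HB.instance Definition _ := GRing.Zmodule_isNzRing.Build skew
  skew_mulA skew_mul1l skew_mul1r skew_mulDl skew_mulDr skew_oner_neq0.

Lemma skew_scaleE c (u : skew) g : (skew_scale c u)@_g = c *: u@_g.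
Proof.
rewrite {2}(skewE (fsubset_refl (msupp u))) !raddf_sum /=.
by apply: eq_bigr => h _; rewrite !mcoeffU scalerMnr.
Qed.

Fact skew_scaleA c c' u :
  skew_scale c (skew_scale c' u) = skew_scale (c * c') u.
Proof. by apply/malgP => g; rewrite !skew_scaleE scalerA. Qed.

Fact skew_scale1 : left_id 1 skew_scale.
Proof. by move=> u; apply/malgP => g; rewrite skew_scaleE scale1r. Qed.

Fact skew_scaleDr : right_distributive skew_scale +%R.
Proof.
by move=> c u v; apply/malgP => g; rewrite !(mcoeffD, skew_scaleE) scalerDr.
Qed.

Fact skew_scaleDl u : {morph skew_scale^~ u : c c' / c + c'}.
Proof.
by move=> c c'; apply/malgP => g; rewrite !(mcoeffD, skew_scaleE) scalerDl.
Qed.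

HB.instance Definition _ := GRing.Zmodule_isLmodule.Build k skew
  skew_scaleA skew_scale1 skew_scaleDr skew_scaleDl.

Lemma mono_scale c g f : c *: mono g f = mono g (c *: f).
Proof.
by apply/malgP => h; rewrite [LHS]skew_scaleE !mcoeffU scalerMnr.
Qed.

Fact skew_scaleAl (c : k) (u v : skew) : c *: (u * v) = (c *: u) * v.
Proof.
elim/skew_ind: u => [|u u' Hu Hu'|g f].
- by rewrite mul0r !scaler0 mul0r.
- by rewrite mulrDl !scalerDr mulrDl Hu Hu'.
elim/skew_ind: v => [|v v' Hv Hv'|h f'].
- by rewrite !mulr0 scaler0.
- by rewrite !mulrDr scalerDr Hv Hv'.
rewrite mono_scale [X in c *: X]mono_mul [RHS]mono_mul mono_scale.
by rewrite scalerAl.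
Qed.

Fact skew_scaleAr (c : k) (u v : skew) : c *: (u * v) = u * (c *: v).
Proof.
elim/skew_ind: u => [|u u' Hu Hu'|g f].
- by rewrite !mul0r scaler0.
- by rewrite !mulrDl scalerDr Hu Hu'.
elim/skew_ind: v => [|v v' Hv Hv'|h f'].
- by rewrite mulr0 !scaler0 mulr0.
- by rewrite mulrDr !scalerDr mulrDr Hv Hv'.
rewrite mono_scale [X in c *: X]mono_mul [RHS]mono_mul mono_scale.
by rewrite linearZ scalerAr.
Qed.

HB.instance Definition _ := GRing.Lmodule_isLalgebra.Build k skew skew_scaleAl.
HB.instance Definition _ := GRing.Lalgebra_isAlgebra.Build k skew skew_scaleAr.

Definition skew_comp (g : G) : set skew := range (mono g).

End Skew.

Arguments mono {k G B} sigma g f.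
Arguments skew_comp {k G B} sigma g.

Record is_graded_antihom (k : fieldType) (G : monoidType)
    (A : graded_algebra k G) (B : comAlgType k)
    (sigma : UMagmaMorphism.type G (aut B)) (Phi : A -> skew_of sigma) : Prop :=
  GradedAntihom {
    antihom_linear : linear Phi;
    antihom1 : Phi 1 = 1;
    antihomM : forall r s, Phi (r * s) = Phi s * Phi r;
    antihom_graded : forall g, Phi @` ga_comp g `<=` skew_comp sigma g
  }.

(* Main.v *)
(** The only real computation is [r v_h = phi(r)(sigma^h x) v_(g h)] for [r] of
    degree [g], got by transporting [r v_1 = phi(r)(y) v_g] at [y = sigma^h x]
    back along the isomorphism [N^x(h) ~ N^y]. Applying [r s] to [v_1] then
    gives [phi(r s) = phi(s) (phi(r) \o sigma^h)] pointwise, and comparing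
    coefficients of [r v_1] in the basis [v^x] gives both the kernel
    and [Phi 1 = 1]; the latter does not need [1] to have degree [1]. *)
Require Import Defs.
From HB Require Import structures.
From mathcomp Require Import all_boot all_algebra finmap.
From mathcomp Require Import boolp classical_sets.
From mathcomp Require Import monalg.

Set Implicit Arguments.
Unset Strict Implicit.
Unset Printing Implicit Defensive.

Import GRing.Theory.

Local Open Scope classical_set_scope.
Local Open Scope ring_scope.

(** * Summing finitely supported families *)

Section TotalSum.
Variables (G : choiceType) (V : zmodType).

(** Applied to an element of N(g), this is the natural map from N(g) to N that forgets the
    degrees. *)
Definition msum (u : {malg V[G]}) : V := \sum_(g <- msupp u) u@_g.

Lemma msumEw (u : {malg V[G]}) (d : {fset G}) :
  (msupp u `<=` d)%fset -> msum u = \sum_(g <- d) u@_g.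
Proof. by move=> ud; apply: big_fset_incl => // g _ /mcoeff_outdom. Qed.

Fact msum_is_zmod_morphism : zmod_morphism msum.
Proof.
move=> u w; pose d := (msupp u `|` msupp w)%fset.
rewrite (@msumEw _ d) ?msuppB_le // (@msumEw u d) ?fsubsetUl //.
rewrite (@msumEw w d) ?fsubsetUr // -sumrB.
by apply: eq_bigr => g _; rewrite mcoeffB.
Qed.

HB.instance Definition _ :=
  GRing.isZmodMorphism.Build {malg V[G]} V msum msum_is_zmod_morphism.

Lemma msumU (n : V) (g : G) : msum << n *g g >> = n.
Proof. by rewrite (msumEw msuppU_le) big_seq_fset1 mcoeffUU. Qed.

Lemma mcoeff_sumU (d : {fset G}) (F : G -> V) (g : G) :
  (\sum_(h <- d) << F h *g h >>)@_g = if g \in d then F g else 0.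
Proof.
rewrite raddf_sum /=; case: ifP => gd.
  rewrite (big_fsetD1 g) //= mcoeffUU big1_fset ?addr0 // => h.
  by rewrite in_fsetD1 mcoeffU => /andP[/negPf ->].
rewrite big1_fset // => h hd _; rewrite mcoeffU.
by case: eqP => // hg; rewrite -hg hd in gd.
Qed.

End TotalSum.

(** * Direct sum decompositions *)

Section Decomposition.
Variables (G : choiceType) (V : zmodType) (Vg : G -> set V).
Hypothesis VP : is_direct_sum Vg.

Lemma direct_sum0 g : Vg g 0.
Proof. by case: VP => /(_ g) []. Qed.

Lemma direct_sumB g u w : Vg g u -> Vg g w -> Vg g (u - w).
Proof. by case: VP => /(_ g) [_ h] _; exact: h. Qed.

Lemma decomposition_comp w g : Vg g (decomposition Vg w)@_g.
Proof. by have [] := decompositionP w VP. Qed.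

Lemma msum_decomposition w : msum (decomposition Vg w) = w.
Proof. by have [_ /esym] := decompositionP w VP. Qed.

Lemma decomposition_uniq w c :
  (forall g, Vg g c@_g) -> msum c = w -> decomposition Vg w = c.
Proof.
move=> cV cw; have [c' [_ c'uniq]] := VP.2 w.
by rewrite -(c'uniq _ (decompositionP w VP)); apply: c'uniq; split.
Qed.

Lemma decomposition_is_zmod_morphism : zmod_morphism (decomposition Vg).
Proof.
move=> u w; apply: decomposition_uniq => [g|].
  by rewrite mcoeffB; apply: direct_sumB; exact: decomposition_comp.
by rewrite raddfB /= !msum_decomposition.
Qed.

Lemma decomposition_homogeneous g w :
  Vg g w -> decomposition Vg w = << w *g g >>.
Proof.
move=> wg; apply: decomposition_uniq => [h|]; last exact: msumU.
rewrite mcoeffU; case: eqP => [<-//|_]; exact: direct_sum0.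
Qed.

End Decomposition.

(** * Homogeneous components in a graded algebra *)

Section GradedAlgebraTheory.
Variables (k : fieldType) (G : monoidType) (A : graded_algebra k G).
Local Notation Ag := (@ga_comp k G A).

Lemma ga_direct_sum : is_direct_sum Ag.
Proof. by case: (ga_graded A). Qed.

Lemma ga_compM g h r s : Ag g r -> Ag h s -> Ag (g * h)%g (r * s).
Proof. by case: (ga_graded A) => _ _ AM; exact: AM. Qed.

Definition component (r : A) (g : G) : A := (decomposition Ag r)@_g.

Lemma componentP r g : Ag g (component r g).
Proof. exact: (decomposition_comp ga_direct_sum). Qed.

Lemma sum_component r :
  r = \sum_(g <- msupp (decomposition Ag r)) component r g.
Proof. by rewrite -[LHS](msum_decomposition ga_direct_sum). Qed.

Lemma component_is_linear g : linear (component^~ g).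
Proof.
have AP := ga_direct_sum.
suff ZE (c : k) r : component (c *: r) g = c *: component r g.
  (* The sum is written as [c *: r - (0 - s)], because [decomposition] has been shown to respect
     differences; the component of [0] vanishes since [0] is homogeneous of degree [g]. *)
  move=> c r s /=; rewrite -{1}[s]opprK -[- s]sub0r /component.
  rewrite !(decomposition_is_zmod_morphism AP) !mcoeffB.
  rewrite -/(component (c *: r) g) ZE /component.
  by rewrite (decomposition_homogeneous AP (direct_sum0 AP g)) mcoeffU mul0rn
    sub0r opprK.
rewrite /component.
(* The candidate decomposition of [c *: r]. Families with values in [A] are scaled by elements of
   [A], hence [c%:A]. *)
pose w : {malg A[G]} := c%:A *: decomposition Ag r.
have wE h : w@_h = c *: (decomposition Ag r)@_h.
  by rewrite mcoeffZ mulr_algl.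
rewrite (@decomposition_uniq _ _ _ AP _ w) ?wE // => [h|].
  rewrite wE; have [_ AZ _] := ga_graded A; apply: AZ; exact: componentP.
rewrite (msumEw (msuppZ_le _ _)) [in RHS](sum_component r) scaler_sumr.
by apply: eq_bigr => h _; rewrite wE.
Qed.

Lemma homogeneous_ind (P : A -> Prop) :
  (forall r s, P r -> P s -> P (r + s)) ->
  (forall g r, Ag g r -> P r) -> forall r, P r.
Proof.
move=> PD PH r; rewrite (sum_component r).
apply: big_ind => // [|g _]; last by apply: PH; exact: componentP.
(* The empty sum: [0] is homogeneous of every degree, here [1%g]. *)
exact: (PH 1%g _ (direct_sum0 ga_direct_sum _)).
Qed.

End GradedAlgebraTheory.

(** * Comparing coefficients in a basis *)

Section BasisTheory.
Variables (k : fieldType) (G : monoidType) (A : graded_algebra k G).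
Variables (N : lmodType A) (v : G -> N).
Hypothesis vP : is_basis v.

(** The restriction of [F] to [d] is packed as a finitely supported [c']; then [c'] and [c] expand
    the same vector, and uniqueness identifies them. Taking [F] as a plain function on [d] allows
    some of its entries to vanish. *)
Lemma basis_sum_inj (d : {fset G}) (c : {malg k[G]}) (F : G -> k) :
  (msupp c `<=` d)%fset ->
  \sum_(g <- d) (F g)%:A *: v g = \sum_(g <- msupp c) (c@_g)%:A *: v g ->
  forall g, g \in d -> F g = c@_g.
Proof.
move=> cd eqFc g gd; pose c' := \sum_(h <- d) << F h *g h >> : {malg k[G]}.
have c'E h : c'@_h = if h \in d then F h else 0 by exact: mcoeff_sumU.
have [c0 [_ c0uniq]] := vP (\sum_(g <- d) (F g)%:A *: v g).
suff : c' = c by move/(congr1 (mcoeff g)); rewrite c'E gd.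
transitivity c0; last exact: c0uniq.
apply/esym/c0uniq; have c'd : (msupp c' `<=` d)%fset.
  apply/fsubsetP => h; rewrite -mcoeff_neq0 c'E.
  by case: (h \in d) => //; rewrite eqxx.
rewrite (big_fset_incl _ c'd) /=; last first.
  by move=> h _ /mcoeff_outdom ->; rewrite !scale0r.
by rewrite [LHS]big_seq [RHS]big_seq; apply: eq_bigr => h hd; rewrite c'E hd.
Qed.

Lemma basis_free (d : {fset G}) (F : G -> k) :
  \sum_(g <- d) (F g)%:A *: v g = 0 -> forall g, g \in d -> F g = 0.
Proof.
move=> F0 g gd; rewrite (@basis_sum_inj d 0 F _ _ g gd) ?mcoeff0 //.
  by rewrite msupp0 fsub0set.
by rewrite F0 msupp0 big_seq_fset0.
Qed.

Lemma basis_scale_inj g (a b : k) : a%:A *: v g = b%:A *: v g -> a = b.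
Proof.
move=> ab; apply/subr0_eq/(@basis_free [fset g]%fset (fun=> a - b) _ g).
  by rewrite big_seq_fset1 !scalerBl ab subrr.
exact: fset11.
Qed.

(** Scalars [c%:A] are central in [A], so [r] moves past them to reach the basis vectors. *)
Lemma basis_annihilator (r : A) :
  (forall g, r *: v g = 0) -> annihilator N r.
Proof.
move=> rv n; have [c [-> _]] := vP n; rewrite scaler_sumr big1 // => g _.
by rewrite scalerA mulr_algr -mulr_algl -scalerA rv scaler0.
Qed.

End BasisTheory.

(** * Values of functions at closed points *)

Section Values.
Variables (k : fieldType) (B : comAlgType k).
Hypothesis affB : reduced_affine_scheme B.
Implicit Types (f : B) (x : closed_point B).

Lemma valueP f x : point_ideal x (f - (value f x)%:A).
Proof. exact: (xgetPex 0 (scheme_kvalued affB x f)). Qed.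

(** Two distinct values would put their difference, a nonzero constant and hence a unit, into the
    maximal ideal at [x]. *)
Lemma value_uniq f x c : point_ideal x (f - c%:A) -> value f x = c.
Proof.
move=> fc; apply: contrapT => /eqP; rewrite -subr_eq0 => neq0.
have [[_ xD xM] x1 _] := point_maximal x; apply: x1.
have /(xM ((value f x - c)^-1)%:A) : point_ideal x (value f x - c)%:A.
  rewrite scalerBl -[_ - _](_ : (f - c%:A) + (- 1) * (f - (value f x)%:A) = _).
    by apply: xD => //; apply: xM; exact: valueP.
  by rewrite mulN1r opprB addrC addrA subrK.
by rewrite mulr_algl scalerA mulVf // scale1r.
Qed.

Lemma value1 x : value 1 x = 1.
Proof.
apply: value_uniq; rewrite scale1r subrr.
by have [[]] := point_maximal x.
Qed.

Lemma value0 x : value 0 x = 0.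
Proof.
apply: value_uniq; rewrite scale0r subrr.
by have [[]] := point_maximal x.
Qed.

Lemma valueM f f' x : value (f * f') x = value f x * value f' x.
Proof.
have [[_ xD xM] _ _] := point_maximal x; apply: value_uniq.
rewrite -[_ - _](_ : f * (f' - (value f' x)%:A) +
  (value f' x)%:A * (f - (value f x)%:A) = _).
  by apply: xD; apply: xM; exact: valueP.
by rewrite !mulrBr mulr_algr !mulr_algl addrA subrK scalerA (mulrC (value f' x)).
Qed.

(** The ideal of [aut_point s x] is the preimage of that of [x] under [pullback s], which fixes
    constants. *)
Lemma value_pullback (s : aut B) f x :
  value (pullback s f) x = value f (aut_point s x).
Proof.
apply: value_uniq; have /= := valueP f (aut_point s x).
by rewrite rmorphB /= [pullback s (_ *: 1)]linearZ /= rmorph1.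
Qed.

End Values.

(** * From the shift N(g) back to N *)

Section ShiftTheory.
Variables (k : fieldType) (G : monoidType) (A : graded_algebra k G).

(** The shift action changes only the index at which a product is stored, so the natural map from
    N(g) to N commutes with [A], even where it is not injective. *)
Lemma msum_shift_act (N : graded_module A) g a (u : shift N g) :
  msum (shift_act a u : {malg N[G]}) = a *: msum (u : {malg N[G]}).
Proof.
rewrite /= /shift_act_val raddf_sum [in RHS](sum_component a) scaler_suml.
apply: eq_bigr => b _; rewrite raddf_sum scaler_sumr.
by apply: eq_bigr => d _; rewrite [LHS]msumU.
Qed.

(** Injectivity of [theta] lifts the relation from [N] to M(g), and summing carries it down to
    [M]. *)
Lemma shift_iso_act (M N : graded_module A) g (theta : shift M g -> N) a b
    (u w : shift M g) : is_shift_iso theta ->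
  a *: theta u = b *: theta w ->
  a *: msum (u : {malg M[G]}) = b *: msum (w : {malg M[G]}).
Proof.
case=> _ /bij_inj theta_inj thetaE _; rewrite -!thetaE => /theta_inj eq_uw.
by rewrite -!msum_shift_act eq_uw.
Qed.

End ShiftTheory.

(** * The map into the skew monoid algebra *)

Section AntihomMap.
Variables (k : fieldType) (G : monoidType) (A : graded_algebra k G).
Variables (B : comAlgType k) (sigma : UMagmaMorphism.type G (aut B)).
Variable phi : {linear A -> B}.

Definition antihom_map (r : A) : skew_of sigma :=
  \sum_(g <- msupp (decomposition (@ga_comp k G A) r))
    mono sigma g (phi (component r g)).

Lemma antihom_map_coeff r g : (antihom_map r)@_g = phi (component r g).
Proof.
rewrite [LHS]mcoeff_sumU; case: ifPn => // /mcoeff_outdom.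
by rewrite /component => ->; rewrite raddf0.
Qed.

Fact antihom_map_is_linear : linear antihom_map.
Proof.
move=> c r s; apply/malgP => g.
rewrite [RHS]mcoeffD [X in _ = X + _]skew_scaleE !antihom_map_coeff.
by rewrite component_is_linear linearP.
Qed.

HB.instance Definition _ :=
  GRing.isLinear.Build k A (skew_of sigma) *:%R antihom_map
    antihom_map_is_linear.

Lemma antihom_mapE g r : ga_comp g r ->
  antihom_map r = mono sigma g (phi r).
Proof.
move=> rg; apply/malgP => h; rewrite antihom_map_coeff /component.
rewrite (decomposition_homogeneous (ga_direct_sum A) rg) !mcoeffU.
by rewrite raddfMn.
Qed.

Lemma antihom_map_eq0 r :
  antihom_map r = 0 <-> forall g, phi (component r g) = 0.
Proof.
split=> [r0 g|r0]; first by rewrite -antihom_map_coeff r0 mcoeff0.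
by apply/malgP => g; rewrite antihom_map_coeff r0 mcoeff0.
Qed.

(** Both sides are biadditive, so homogeneous [r] and [s] suffice. There the hypothesis is the rule
    for multiplying [phi(s) t^h] by [phi(r) t^g], with [t^h t^g = t^(g h)]. *)
Lemma antihom_mapM :
  (forall g h r s, @ga_comp k G A g r -> @ga_comp k G A h s ->
     phi (r * s) = phi s * pullback (sigma h) (phi r)) ->
  forall r s, antihom_map (r * s) = antihom_map s * antihom_map r.
Proof.
move=> phiM r s; elim/homogeneous_ind: r => [r r' Hr Hr'|g r rg].
  by rewrite mulrDl !raddfD /= mulrDr Hr Hr'.
elim/homogeneous_ind: s => [s s' Hs Hs'|h s sh].
  by rewrite mulrDr !raddfD /= mulrDl Hs Hs'.
rewrite (antihom_mapE (ga_compM rg sh)) (antihom_mapE rg) (antihom_mapE sh).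
by rewrite [RHS]mono_mul (phiM g h).
Qed.

End AntihomMap.

(** * The antihomomorphism and its kernel *)

Theorem theorem2p5 (k : closedFieldType) (char0 : [pchar k] =i pred0)
    (G : monoidType) (A : graded_algebra k G)
    (B : comAlgType k) (affB : reduced_affine_scheme B)
    (N : closed_point B -> graded_module A)
    (v : forall x, homogeneous_basis (N x))
    (phi : {linear A -> B})
    (phiE : forall x g (r : A), ga_comp g r ->
       r *: v x 1%g = (value (phi r) x)%:A *: v x g)
    (sigma : UMagmaMorphism.type G (aut B))
    (shift_sigma : forall x g, exists theta : shift (N x) g ->
         N (aut_point (sigma g) x),
       is_shift_iso theta /\
       forall d, theta (shift_elt (hb_mem (v x) (d * g)%g)) =
         v (aut_point (sigma g) x) d) :
  exists Phi : A -> skew_of sigma,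
    [/\ forall g r, ga_comp g r -> Phi r = mono sigma g (phi r),
        is_graded_antihom Phi
      & [set r | Phi r = 0] = \bigcap_x annihilator (N x)].
Proof.
have v_act x g h r : ga_comp g r ->
    r *: v x h = (value (phi r) (aut_point (sigma h) x))%:A *: v x (g * h)%g.
  move=> rg; have [theta [isoP thetaE]] := shift_sigma x h.
  (* With y the image of x under [sigma h], the elements of degrees [1] and [g] in the shift go to
     [v y 1] and [v y g] under [theta], but sum to [v x h] and [v x (g h)]. *)
  have := @shift_iso_act _ _ _ _ _ _ theta r
    (value (phi r) (aut_point (sigma h) x))%:A
    (shift_elt (hb_mem (v x) (1 * h)%g))
    (shift_elt (hb_mem (v x) (g * h)%g)) isoP.
  by rewrite !thetaE /= !msumU mul1g; apply; exact: phiE.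
have v1_act x r : r *: v x 1%g =
    \sum_(g <- msupp (decomposition (@ga_comp _ _ A) r))
      (value (phi (component r g)) x)%:A *: v x g.
  rewrite {1}(sum_component r) scaler_suml; apply: eq_bigr => g _.
  by apply: phiE; exact: componentP.
have phi_out r g : g \notin msupp (decomposition (@ga_comp _ _ A) r) ->
    phi (component r g) = 0.
  by move/mcoeff_outdom; rewrite /component => ->; rewrite raddf0.
have phiM g h r s : ga_comp g r -> ga_comp h s ->
    phi (r * s) = phi s * pullback (sigma h) (phi r).
  move=> rg sh; apply: (scheme_separated affB) => x.
  rewrite valueM // value_pullback //.
  apply: (basis_scale_inj (hb_basis (v x)) (g := (g * h)%g)).
  rewrite -(phiE _ _ _ (ga_compM rg sh)) -scalerA (phiE _ _ _ sh).
  (* The scalar [phi(s)(x)] is pulled out past [r], leaving [r *: v x h] for [v_act]. *)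
  rewrite scalerA mulr_algr -[_ *: r]mulr_algl -(scalerA _%:A r).
  by rewrite (v_act _ _ _ _ rg) [LHS]scalerA mulr_algl scalerA.
have phi1 g : phi (component 1 g) = if g == 1%g then 1 else 0.
  apply: (scheme_separated affB) => x.
  set d := msupp (decomposition (@ga_comp _ _ A) 1).
  (* Coefficients of [1 *: v x 1 = v x 1] are compared. The degree [1%g] is adjoined to [d] because
     it is not yet known to occur in the decomposition of [1]. *)
  have valE : forall h, h \in (1%g |` d)%fset ->
      value (phi (component 1 h)) x = (<< 1 *g 1%g >> : {malg k[G]})@_h.
    apply: (basis_sum_inj (hb_basis (v x))
      (F := fun h => value (phi (component 1 h)) x)).
      by rewrite (fsubset_trans msuppU_le) ?fsubsetUl.
    have <- : 1 *: v x 1%g = \sum_(h <- (1%g |` d)%fset)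
        (value (phi (component 1 h)) x)%:A *: v x h.
      rewrite v1_act; apply: big_fset_incl; first exact: fsubsetUr.
      by move=> h _ /phi_out ->; rewrite value0 // !scale0r.
    rewrite (big_fset_incl _ msuppU_le) /= => [|h _ /mcoeff_outdom ->].
      by rewrite big_seq_fset1 mcoeffUU !scale1r.
    by rewrite !scale0r.
  have [gd|] := boolP (g \in (1%g |` d)%fset).
    by rewrite valE // mcoeffU eq_sym; case: eqP; rewrite (value0, value1).
  rewrite in_fset1U negb_or => /andP[/negPf -> gd].
  by rewrite phi_out.
exists (antihom_map sigma phi); split=> [g r rg||].
- exact: antihom_mapE.
- split; first exact: antihom_map_is_linear.
  + apply/malgP => g; rewrite antihom_map_coeff phi1.
    by rewrite [RHS]mcoeffU eq_sym; case: eqP.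
  + exact: antihom_mapM.
  + by move=> g _ [r rg <-]; rewrite (antihom_mapE _ _ rg); exists (phi r).
apply/seteqP; split=> r /=.
- move=> /antihom_map_eq0 r0 x _.
  apply: (basis_annihilator (hb_basis (v x))) => h.
  rewrite (sum_component r) scaler_suml big1 // => g _.
  (* The vanishing of [phi (component r g)] is used at the image of [x] under [sigma h]. *)
  by rewrite (v_act _ _ _ _ (componentP r g)) r0 value0 // !scale0r.
(* Testing on [v x 1] keeps the components of [r] apart: they land on distinct basis vectors
   [v x g], whereas on [v x h] different degrees could collide in [g h]. *)
- move=> rN; apply/antihom_map_eq0 => g.
  apply: (scheme_separated affB) => x; rewrite value0 //.
  have [gd|/phi_out ->] :=
    boolP (g \in msupp (decomposition (@ga_comp _ _ A) r)); last exact: value0.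
  apply: (basis_free (hb_basis (v x)) _ gd
    (F := fun h => value (phi (component r h)) x)).
  by rewrite -v1_act; exact: rN.
Qed.
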